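(* Let $(M,0)\subset(\mathbb{C}^N,0)$ be a formal generic submanifold of codimension $d$ which is of finite type at $0$. Let $(E,0)\subset(\mathbb{C}^m,0)$ be a formal totally real manifold, and let $H\colon(\mathbb{C}^N,0)\to(\mathbb{C}^m,0)$ be a formal meromorphic map which maps $(M,0)$ into $(E,0)$. Then $H$ is constant; that is, writing $H=\frac{N}{D}$ with $N=(N_1,\dots,N_m)$ in the coordinates of $\mathbb{C}^m$ in which $E$ is given by $\operatorname{Im}\eta=0$, there is $c=(c_1,\dots,c_m)\in\mathbb{C}^m$ such that $N_j=c_jD$ for $j=1,\dots,m$.
   Context: Notation. $\mathbb{C}[[x]]$ is the ring of formal power series in the variables $x$. For a formal power series $f$, $\bar f$ denotes the series obtained by complex conjugating the coefficients of $f$. The dimension $N$ of the source space and the numerator $N=(N_1,\dots,N_m)$ of $H$ are different objects. Formal generic submanifold. Let $Z=(Z_1,\dots,Z_N)$, $\zeta=(\zeta_1,\dots,\zeta_N)$ ($\zeta$ plays the role of $\bar Z$). A formal generic (real) submanifold $(M,0)\subset(\mathbb{C}^N,0)$ of codimension $d$ is given by its manifold ideal $\mathcal{I}(M,0)\subset\mathbb{C}[[Z,\zeta]]$, which is required to be generated by $d$ series $\rho_1,\dots,\rho_d$ with $\rho_j(0,0)=0$ such that (1) $\overline{\rho_j}(\zeta,Z)=\rho_j(Z,\zeta)$ for all $j$, and (2) the vectors $\rho_{j;Z}(0)=\left(\frac{\partial\rho_j}{\partial Z_1}(0),\dots,\frac{\partial\rho_j}{\partial Z_N}(0)\right)$,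 $j=1,\dots,d$, are linearly independent. Finite type. A formal $(1,0)$-vector field is $\sum_j a_j(Z,\zeta)\frac{\partial}{\partial Z_j}$ and a formal $(0,1)$-vector field is $\sum_j b_j(Z,\zeta)\frac{\partial}{\partial\zeta_j}$, with $a_j,b_j\in\mathbb{C}[[Z,\zeta]]$; a formal vector field $X$ is tangent to $(M,0)$ if $X(\mathcal{I}(M,0))\subset\mathcal{I}(M,0)$. $(M,0)$ is of finite type at $0$ (in the sense of Kohn and Bloom-Graham) if the Lie algebra generated by the formal $(1,0)$- and $(0,1)$-vector fields tangent to $(M,0)$, evaluated at $0$, spans the complexified tangent space of $(M,0)$ at $0$, i.e. the $(2N-d)$-dimensional space of vectors $v\in\mathbb{C}^{2N}$ annihilated by $d\rho_1(0),\dots,d\rho_d(0)$. Formal totally real manifold. $(E,0)\subset(\mathbb{C}^m,0)$ is a formal totally real manifold if it is a formal real submanifold which in suitable formal holomorphic coordinates $\eta\in\mathbb{C}^m$ is given by $\operatorname{Im}\eta=0$, meaning that $\mathcal{I}(E,0)\subset\mathbb{C}[[\eta,\nu]]$ ($\nu$ playing the role of $\bar\eta$) is generated by $\frac{1}{2i}(\nu_j-\eta_j)$, $j=1,\dots,m$. Such coordinates are fixed on $\mathbb{C}^m$. Formal meromorphic map. A formal meromorphic map $H\colon(\mathbb{C}^N,0)\to(\mathbb{C}^m,0)$ is given by $H=\frac{N}{D}$, where $D\in\mathbb{C}[[Z]]$ is not identically zero and $N=(N_1,\dots,N_m)$ with $N_j\in\mathbb{C}[[Z]]$. Mapping $(M,0)$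 into $(E,0)$. With coordinates on $\mathbb{C}^m$ such that $E$ is given by $\operatorname{Im}\eta=0$, $H=N/D$ maps $(M,0)$ into $(E,0)$ if for every formal holomorphic map $\gamma(t)=(\gamma_1(t),\gamma_2(t))\colon(\mathbb{C}^{2N-d},0)\to(\mathbb{C}^{2N},0)$ satisfying $\rho(\gamma_1(t),\gamma_2(t))=0$ for every $\rho\in\mathcal{I}(M,0)$, one has $N_j(\gamma_1(t))\,\bar D(\gamma_2(t))-\bar N_j(\gamma_2(t))\,D(\gamma_1(t))=0$ for every $j=1,\dots,m$. *)

(* Defs.v *)
From HB Require Import structures.
From mathcomp Require Import all_boot all_order all_algebra.
From mathcomp Require Import boolp reals complex.
From mathcomp Require Import mpoly.

Set Implicit Arguments.
Unset Strict Implicit.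
Unset Printing Implicit Defensive.

Import Order.TTheory GRing.Theory Num.Theory.

Local Open Scope ring_scope.

Declare Scope fps_scope.
Delimit Scope fps_scope with FPS.

(* The formal power series in n variables with coefficients in R; the
   exponents are the monomials 'X_{1..n} of the multivariate polynomials. *)
Record fps (R : Type) (n : nat) := FPS { coef_fps : 'X_{1..n} -> R }.

Section FpsRing.
Variables (R : comNzRingType) (n : nat).
Implicit Types (f g h : fps R n) (c : R) (m : 'X_{1..n}).

Lemma fpsP f g : coef_fps f =1 coef_fps g <-> f = g.
Proof.
split=> [|-> //]; case: f g => [f] [g] /= fg; congr FPS; exact/funext.
Qed.

HB.instance Definition _ := gen_eqMixin (fps R n).
HB.instance Definition _ := gen_choiceMixin (fps R n).

Definition fpsC c : fps R n := FPS (fun m => if m == 0%MM then c else 0).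

Definition fpsX (i : 'I_n) : fps R n := FPS (fun m => (m == U_(i)%MM)%:R).

Definition add_fps f g := FPS (fun m => coef_fps f m + coef_fps g m).

Definition opp_fps f := FPS (fun m => - coef_fps f m).

Definition scale_fps c f := FPS (fun m => c * coef_fps f m).

Definition mul_fps f g := FPS (fun m =>
  \sum_(k : 'X_{1..n < (mdeg m).+1, (mdeg m).+1} | m == (k.1 + k.2)%MM)
     coef_fps f k.1 * coef_fps g k.2).

Fact add_fpsA : associative add_fps.
Proof. by move=> f g h; apply/fpsP => m /=; rewrite addrA. Qed.

Fact add_fpsC : commutative add_fps.
Proof. by move=> f g; apply/fpsP => m /=; rewrite addrC. Qed.

Fact add_0fps : left_id (fpsC 0) add_fps.
Proof. by move=> f; apply/fpsP => m /=; rewrite if_same add0r. Qed.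

Fact add_Nfps : left_inverse (fpsC 0) opp_fps add_fps.
Proof. by move=> f; apply/fpsP => m /=; rewrite if_same addNr. Qed.

HB.instance Definition _ :=
  GRing.isZmodule.Build (fps R n) add_fpsA add_fpsC add_0fps add_Nfps.

Definition trunc_fps b f : {mpoly R[n]} :=
  \sum_(m : 'X_{1..n < b}) coef_fps f m *: 'X_[m].

Lemma mcoeff_trunc b f m : (mdeg m < b)%N -> (trunc_fps b f)@_m = coef_fps f m.
Proof. exact: (mcoeff_mpoly (coef_fps f)). Qed.

Lemma mul_fpsE b f g m : (mdeg m < b)%N ->
  coef_fps (mul_fps f g) m = (trunc_fps b f * trunc_fps b g)@_m.
Proof.
move=> mb; rewrite mcoeffM /=; apply: eq_bigr => k _.
by rewrite !mcoeff_trunc // (leq_trans (bmdeg _)).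
Qed.

Lemma mcoeffM_eq (p p' q q' : {mpoly R[n]}) m :
  (forall k, (mdeg k <= mdeg m)%N -> p@_k = p'@_k) ->
  (forall k, (mdeg k <= mdeg m)%N -> q@_k = q'@_k) ->
  (p * q)@_m = (p' * q')@_m.
Proof.
move=> pp' qq'; rewrite !mcoeffM; apply: eq_bigr => k _.
by rewrite pp' ?qq' // -ltnS bmdeg.
Qed.

Fact mul_fpsA : associative mul_fps.
Proof.
move=> f g h; apply/fpsP => m; pose b := (mdeg m).+1.
rewrite !(mul_fpsE (b := b)) //.
transitivity (trunc_fps b f * (trunc_fps b g * trunc_fps b h))@_m.
  apply: mcoeffM_eq => // k km.
  by rewrite mcoeff_trunc ?ltnS // (mul_fpsE (b := b)) ?ltnS.
rewrite mulrA; apply: mcoeffM_eq => // k km.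
by rewrite mcoeff_trunc ?ltnS // (mul_fpsE (b := b)) ?ltnS.
Qed.

Fact mul_fpsC : commutative mul_fps.
Proof.
move=> f g; apply/fpsP => m.
by rewrite !(mul_fpsE (b := (mdeg m).+1)) // mulrC.
Qed.

Fact mul_1fps : left_id (fpsC 1) mul_fps.
Proof.
move=> f; apply/fpsP => m; pose b := (mdeg m).+1.
rewrite (mul_fpsE (b := b)) //.
have -> : trunc_fps b (fpsC 1) = 1.
  apply/mpolyP => k; case: (ltnP (mdeg k) b) => [kb|bk].
    by rewrite mcoeff_trunc //= mcoeff1; case: eqP.
  rewrite mcoeff1 /trunc_fps raddf_sum /= big1 => [|a _].
    by rewrite [k == _]eq_sym; case: eqP bk => // <-; rewrite mdeg0.
  rewrite mcoeffZ mcoeffX; case: (eqVneq (bmnm a) k) => [ak|]; last first.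
    by rewrite mulr0.
  by rewrite -ak leqNgt bmdeg in bk.
by rewrite mul1r mcoeff_trunc.
Qed.

Fact mul_fpsDl : left_distributive mul_fps +%R.
Proof.
move=> f g h; apply/fpsP => m /=.
by rewrite -big_split; apply: eq_bigr => k _; rewrite mulrDl.
Qed.

Fact fps1_neq0 : fpsC 1 != 0.
Proof.
by apply/eqP => /fpsP /(_ 0%MM) /=; rewrite !eqxx => /eqP; rewrite oner_eq0.
Qed.

HB.instance Definition _ := GRing.Zmodule_isComNzRing.Build (fps R n)
  mul_fpsA mul_fpsC mul_1fps mul_fpsDl fps1_neq0.

Fact scale_fpsA a b f : scale_fps a (scale_fps b f) = scale_fps (a * b) f.
Proof. by apply/fpsP => m /=; rewrite mulrA. Qed.

Fact scale_1fps : left_id 1 scale_fps.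
Proof. by move=> f; apply/fpsP => m /=; rewrite mul1r. Qed.

Fact scale_fpsDr : right_distributive scale_fps +%R.
Proof. by move=> c f g; apply/fpsP => m /=; rewrite mulrDr. Qed.

Fact scale_fpsDl f : {morph scale_fps^~ f : a b / a + b}.
Proof. by move=> a b; apply/fpsP => m /=; rewrite mulrDl. Qed.

HB.instance Definition _ := GRing.Zmodule_isLmodule.Build R (fps R n)
  scale_fpsA scale_1fps scale_fpsDr scale_fpsDl.

Definition eval0 f : R := coef_fps f 0%MM.

Definition deriv_fps (i : 'I_n) f : fps R n :=
  FPS (fun m => coef_fps f (m + U_(i))%MM *+ (m i).+1).

Definition ideal_gen (I : finType) (rho : I -> fps R n) f : Prop :=
  exists a : I -> fps R n, f = \sum_i a i * rho i.

End FpsRing.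

Notation "''d_' i f" := (deriv_fps i f)
  (at level 10, i at level 8, f at level 9, format "''d_' i  f") : fps_scope.

(* f(g_1, ..., g_n), for g_1, ..., g_n without constant term: as g ^ a has order
   at least |a|, only the exponents a with |a| <= |m| contribute to the
   coefficient at m.  The value is meaningless for the other g. *)
Definition subst_fps (R : comNzRingType) (n k : nat)
    (f : fps R n) (g : 'I_n -> fps R k) : fps R k :=
  FPS (fun m => \sum_(a : 'X_{1..n < (mdeg m).+1})
    coef_fps f a * coef_fps (\prod_(i < n) g i ^+ (a i)) m).

Definition conj_fps (C : numClosedFieldType) (n : nat) (f : fps C n) : fps C n :=
  FPS (fun m => (coef_fps f m)^*).

(* C[[Z, zeta]], Z, zeta in C^n, is [fps C (n + n)]: the first n variables are
   the Z_j, the last n ones are the zeta_j. *)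
Definition Zvar (R : comNzRingType) n (j : 'I_n) : fps R (n + n) :=
  fpsX R (lshift n j).
Definition zetavar (R : comNzRingType) n (j : 'I_n) : fps R (n + n) :=
  fpsX R (rshift n j).

Definition join_vars (T : Type) n (u v : 'I_n -> T) (i : 'I_(n + n)) : T :=
  match split i with inl j => u j | inr j => v j end.

Section GenericSubmanifold.
Variable C : numClosedFieldType.

Local Open Scope fps_scope.

Record formal_generic_submanifold (n d : nat) := FormalGenericSubmanifold {
  defining : 'I_d -> fps C (n + n);
  defining0 : forall j, eval0 (defining j) = 0;
  defining_real : forall j,
    subst_fps (conj_fps (defining j)) (join_vars (@zetavar C n) (@Zvar C n))
    = defining j;
  defining_free :
    row_free (\matrix_(j < d, k < n) eval0 ('d_(lshift n k) (defining j)))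
}.

Definition manifold_ideal n d (M : formal_generic_submanifold n d) :
  fps C (n + n) -> Prop := ideal_gen (defining M).

(* \sum_i X_i d/dx_i is the row vector of its coefficients. *)
Definition formal_vf (n : nat) := 'rV[fps C n]_n.

Definition vf_app n (X : formal_vf n) (f : fps C n) : fps C n :=
  \sum_i X 0 i * 'd_i f.

Definition lie_bracket n (X Y : formal_vf n) : formal_vf n :=
  \row_i (vf_app X (Y 0 i) - vf_app Y (X 0 i)).

(* The complex Lie algebra generated by S. *)
Inductive lie_gen n (S : formal_vf n -> Prop) : formal_vf n -> Prop :=
| lie_gen_base X : S X -> lie_gen S X
| lie_gen_zero : lie_gen S 0
| lie_gen_add X Y : lie_gen S X -> lie_gen S Y -> lie_gen S (X + Y)
| lie_gen_scale (c : C) X : lie_gen S X -> lie_gen S (fpsC n c *: X)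
| lie_gen_bracket X Y :
    lie_gen S X -> lie_gen S Y -> lie_gen S (lie_bracket X Y).

Definition vf10 n (X : formal_vf (n + n)) : Prop :=
  forall j : 'I_n, X 0 (rshift n j) = 0.

Definition vf01 n (X : formal_vf (n + n)) : Prop :=
  forall j : 'I_n, X 0 (lshift n j) = 0.

Definition tangent_vf n d (M : formal_generic_submanifold n d)
    (X : formal_vf (n + n)) : Prop :=
  forall f, manifold_ideal M f -> manifold_ideal M (vf_app X f).

Definition vf_at0 n (X : formal_vf n) : 'rV[C]_n := \row_i eval0 (X 0 i).

Definition complex_tangent_space n d (M : formal_generic_submanifold n d)
    (v : 'rV[C]_(n + n)) : Prop :=
  forall j, \sum_i v 0 i * eval0 ('d_i (defining M j)) = 0.

Definition lin_span n (S : 'rV[C]_n -> Prop) (v : 'rV[C]_n) : Prop :=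
  exists2 s : seq 'rV[C]_n, (forall u, u \in s -> S u) & v \in <<s>>%VS.

Definition finite_type n d (M : formal_generic_submanifold n d) : Prop :=
  let g := lie_gen (fun X => (vf10 X \/ vf01 X) /\ tangent_vf M X) in
  forall v, lin_span (fun u => exists2 X, g X & u = vf_at0 X) v
            <-> complex_tangent_space M v.

(* In the coordinates eta of C^m in which the manifold is Im eta = 0. *)
Record formal_totally_real_manifold (m : nat) := FormalTotallyRealManifold {
  tr_ideal : fps C (m + m) -> Prop;
  tr_idealP : forall f, tr_ideal f <->
    ideal_gen (fun j : 'I_m => (2 * 'i)^-1 *: (zetavar C j - Zvar C j)) f
}.

Record formal_meromorphic_map (n m : nat) := FormalMeromorphicMap {
  mnumer : 'I_m -> fps C n;
  mdenom : fps C n;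
  mdenom_neq0 : mdenom != 0
}.

(* H is expressed in the coordinates of C^m in which E is Im eta = 0, so that
   E only enters through its type. *)
Definition maps_into n d m (M : formal_generic_submanifold n d)
    (E : formal_totally_real_manifold m) (H : formal_meromorphic_map n m) : Prop :=
  forall gamma1 gamma2 : 'I_n -> fps C (n + n - d),
    (forall i, eval0 (gamma1 i) = 0) -> (forall i, eval0 (gamma2 i) = 0) ->
    (forall rho, manifold_ideal M rho ->
       subst_fps rho (join_vars gamma1 gamma2) = 0) ->
    forall j, subst_fps (mnumer H j) gamma1
                * subst_fps (conj_fps (mdenom H)) gamma2
              - subst_fps (conj_fps (mnumer H j)) gamma2
                * subst_fps (mdenom H) gamma1 = 0.

End GenericSubmanifold.

(* Main.v *)
(** Parametrize M by a formal immersion gamma = (gamma1, gamma2) and let phi be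
    the pullback along gamma.  On M, the fraction h = N_j(Z) / D(Z) equals
    conj N_j(zeta) / conj D(zeta); the first form is killed by the tangent
    (0,1)-vector fields and the second one by the tangent (1,0)-vector fields,
    hence h is killed by the Lie algebra that they generate.  By finite type
    this Lie algebra spans the tangent space at 0, hence, up to a nonzero
    factor, every d/dt_k is a combination of its elements.  So h(gamma) has
    zero derivatives and is a constant c; finally phi is injective on C[[Z]]
    because M is generic, and N_j - c D is in its kernel. *)

Require Import Defs.
From HB Require Import structures.
From mathcomp Require Import all_boot all_order all_algebra.
From mathcomp Require Import boolp reals complex.
From mathcomp Require Import ssrcomplements mpoly ring.

Set Implicit Arguments.
Unset Strict Implicit.
Unset Printing Implicit Defensive.

Import Order.TTheory GRing.Theory Num.Theory.

Local Open Scope ring_scope.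
Local Open Scope fps_scope.

Arguments eval0 : simpl never.

(** * Coefficients, constant terms and partial derivatives of power series *)

Section FpsTheory.
Variables (R : comNzRingType) (n : nat).
Implicit Types (f g h : fps R n) (m : 'X_{1..n}).

Lemma coef_fpsD f g m : coef_fps (f + g) m = coef_fps f m + coef_fps g m.
Proof. by []. Qed.

Lemma coef_fpsN f m : coef_fps (- f) m = - coef_fps f m.
Proof. by []. Qed.

Lemma coef_fpsB f g m : coef_fps (f - g) m = coef_fps f m - coef_fps g m.
Proof. by []. Qed.

Lemma coef_fpsZ c f m : coef_fps (c *: f) m = c * coef_fps f m.
Proof. by []. Qed.

Lemma coef_fps0 m : coef_fps (0 : fps R n) m = 0.
Proof. exact: if_same. Qed.

Lemma coef_fpsM f g m : coef_fps (f * g) m =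
  \sum_(k : 'X_{1..n < (mdeg m).+1, (mdeg m).+1} | m == (k.1 + k.2)%MM)
     coef_fps f k.1 * coef_fps g k.2.
Proof. by []. Qed.

Lemma coef_fps_sum (I : Type) (r : seq I) (P : pred I) (F : I -> fps R n) m :
  coef_fps (\sum_(i <- r | P i) F i) m = \sum_(i <- r | P i) coef_fps (F i) m.
Proof.
exact: (big_morph (fun f => coef_fps f m) (fun f g => coef_fpsD f g m)
          (coef_fps0 m)).
Qed.

Lemma fpsC_is_zmod_morphism : zmod_morphism (fpsC n : R -> fps R n).
Proof.
by move=> a b; apply/fpsP => m; rewrite coef_fpsB /=; case: eqP; rewrite ?subr0.
Qed.

HB.instance Definition _ :=
  GRing.isZmodMorphism.Build R (fps R n) (fpsC n) fpsC_is_zmod_morphism.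

Lemma coef_fpsCM c f m : coef_fps (fpsC n c * f) m = c * coef_fps f m.
Proof.
rewrite (mul_fpsE (b := (mdeg m).+1)) //.
rewrite (mcoeffM_eq (p' := c%:MP) (q' := trunc_fps (mdeg m).+1 f)) //.
  by rewrite mcoeffCM mcoeff_trunc.
move=> k km; rewrite mcoeff_trunc // mcoeffC /=.
by case: eqP => _; rewrite ?mulr1 ?mulr0.
Qed.

Lemma scale_fpsE c f : c *: f = fpsC n c * f.
Proof. by apply/fpsP => m; rewrite coef_fpsCM. Qed.

Lemma fpsC_is_monoid_morphism : monoid_morphism (fpsC n : R -> fps R n).
Proof.
split=> // a b; apply/fpsP => m; rewrite coef_fpsCM /=.
by case: eqP; rewrite ?mulr0.
Qed.

HB.instance Definition _ :=
  GRing.isMonoidMorphism.Build R (fps R n) (fpsC n) fpsC_is_monoid_morphism.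

Lemma eval0_is_zmod_morphism : zmod_morphism (@eval0 R n).
Proof. by []. Qed.

HB.instance Definition _ :=
  GRing.isZmodMorphism.Build (fps R n) R (@eval0 R n) eval0_is_zmod_morphism.

Lemma eval0D f g : eval0 (f + g) = eval0 f + eval0 g.
Proof. by []. Qed.

Lemma eval0M f g : eval0 (f * g) = eval0 f * eval0 g.
Proof.
rewrite /eval0 (mul_fpsE (b := 1)) ?mdeg0 // (rmorphM (mcoeff 0%MM)) /=.
by rewrite !mcoeff_trunc ?mdeg0.
Qed.

Lemma eval0_is_monoid_morphism : monoid_morphism (@eval0 R n).
Proof. by split=> [|f g]; [rewrite /eval0 /= eqxx | exact: eval0M]. Qed.

HB.instance Definition _ :=
  GRing.isMonoidMorphism.Build (fps R n) R (@eval0 R n)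
    eval0_is_monoid_morphism.

Lemma eval0C (c : R) : eval0 (fpsC n c) = c.
Proof. by rewrite /eval0 /= eqxx. Qed.

Lemma eval0X (i : 'I_n) : eval0 (fpsX R i) = 0.
Proof.
by rewrite /eval0 /=; case: eqP => // /(congr1 mdeg); rewrite mdeg0 mdeg1.
Qed.

Lemma eval0Z c f : eval0 (c *: f) = c * eval0 f.
Proof. by []. Qed.

Lemma coef_deriv i f m :
  coef_fps ('d_i f) m = coef_fps f (m + U_(i))%MM *+ (m i).+1.
Proof. by []. Qed.

Lemma deriv_is_zmod_morphism i : zmod_morphism (@deriv_fps R n i).
Proof. by move=> f g; apply/fpsP => m; rewrite coef_fpsB /= mulrnBl. Qed.

HB.instance Definition _ i := GRing.isZmodMorphism.Build (fps R n) (fps R n)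
  (@deriv_fps R n i) (deriv_is_zmod_morphism i).

Lemma derivD i f g : 'd_i (f + g) = 'd_i f + 'd_i g.
Proof. exact: raddfD. Qed.

(** This is Leibniz' rule for truncations. The coefficient at [m] of a derivative involves degree
    [(mdeg m).+1], hence the truncation bound [b = (mdeg m).+2]. *)
Lemma derivM i f g : 'd_i (f * g) = 'd_i f * g + f * 'd_i g.
Proof.
apply/fpsP => m; pose b := (mdeg m).+2.
have tE (h : fps R n) k : (mdeg k <= mdeg m)%N ->
    (trunc_fps (mdeg m).+1 ('d_i h))@_k = ((trunc_fps b h)^`M(i))@_k.
  move=> km; rewrite mcoeff_trunc // coef_deriv mcoeff_deriv mcoeff_trunc //.
  by rewrite mdegD mdeg1 addn1.
have bE (h : fps R n) k : (mdeg k <= mdeg m)%N ->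
    (trunc_fps (mdeg m).+1 h)@_k = (trunc_fps b h)@_k.
  by move=> km; rewrite !mcoeff_trunc // ltnS (leq_trans km).
rewrite coef_fpsD !(mul_fpsE (b := (mdeg m).+1)) // coef_deriv.
rewrite (mul_fpsE (b := b)) ?mdegD ?mdeg1 ?addn1 // -mcoeff_deriv mderivM.
rewrite mcoeffD; congr (_ + _); apply: mcoeffM_eq => k km;
  by rewrite ?tE ?bE.
Qed.

Lemma derivC i (c : R) : 'd_i (fpsC n c) = 0.
Proof.
apply/fpsP => m; rewrite coef_fps0 /= -mdeg_eq0 mdegD mdeg1 addn1 /=.
by rewrite mul0rn.
Qed.

Lemma derivX (i j : 'I_n) : 'd_i (fpsX R j) = (i == j)%:R.
Proof.
apply/fpsP => m /=.
have -> : (i == j)%:R = fpsC n ((i == j)%:R) :> fps R n by rewrite rmorph_nat.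
have [->|ij] := eqVneq i j; rewrite /=.
  rewrite -[X in _ == X]add0m eqm_add2r.
  by case: eqP => [->|]; rewrite ?mnm0E ?mul0rn.
rewrite if_same; case: eqP => [/mnmP/(_ i)|_]; last by rewrite mul0rn.
by rewrite mnmDE !mnm1E eqxx eq_sym (negbTE ij) addn1.
Qed.

Lemma derivZ i c f : 'd_i (c *: f) = c *: 'd_i f.
Proof. by rewrite !scale_fpsE derivM derivC mul0r add0r. Qed.

Lemma deriv_comm i j f : 'd_i ('d_j f) = 'd_j ('d_i f).
Proof.
apply/fpsP => m /=; rewrite -!mulrnA -!addmA [(U_(j) + _)%MM]addmC.
congr (_ *+ _); rewrite !mnmDE !mnm1E; have [->//|ij] := eqVneq i j.
by rewrite !addn0 mulnC.
Qed.

End FpsTheory.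

(** * Congruence of power series up to a given order *)

Section Congruence.
Variables (R : comNzRingType) (n : nat).
Implicit Types (f g h : fps R n) (m : 'X_{1..n}) (b : nat).

(** Congruence modulo the [b]-th power of the ideal of series without constant term. *)
Definition eqmod b f g :=
  forall m, (mdeg m < b)%N -> coef_fps f m = coef_fps g m.

Lemma eqmod_sym b f g : eqmod b f g -> eqmod b g f.
Proof. by move=> fg m mb; rewrite fg. Qed.

Lemma eqmod_trans b g f h : eqmod b f g -> eqmod b g h -> eqmod b f h.
Proof. by move=> fg gh m mb; rewrite fg // gh. Qed.

Lemma eqmod_le a b f g : (a <= b)%N -> eqmod b f g -> eqmod a f g.
Proof. by move=> ab fg m ma; rewrite fg // (leq_trans ma). Qed.

Lemma eqmod_eq f g : (forall b, eqmod b f g) -> f = g.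
Proof. by move=> fg; apply/fpsP => m; apply: (fg (mdeg m).+1). Qed.

Lemma eqmod1P f g : eqmod 1 f g <-> eval0 f = eval0 g.
Proof.
split=> [|fg m]; first by apply; rewrite mdeg0.
by rewrite ltnS leqn0 mdeg_eq0 => /eqP ->.
Qed.

Lemma eqmodD b f f' g g' : eqmod b f f' -> eqmod b g g' ->
  eqmod b (f + g) (f' + g').
Proof. by move=> ff gg m mb; rewrite !coef_fpsD ff ?gg. Qed.

Lemma eqmodN b f f' : eqmod b f f' -> eqmod b (- f) (- f').
Proof. by move=> ff m mb; rewrite !coef_fpsN ff. Qed.

Lemma eqmodB b f f' g g' : eqmod b f f' -> eqmod b g g' ->
  eqmod b (f - g) (f' - g').
Proof. by move=> ff gg; apply/eqmodD/eqmodN. Qed.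

Lemma eqmod_subr0 b f g : eqmod b (f - g) 0 <-> eqmod b f g.
Proof.
split=> fg m mb.
  by have /eqP := fg m mb; rewrite coef_fpsB coef_fps0 subr_eq0 => /eqP.
by rewrite coef_fpsB fg // subrr coef_fps0.
Qed.

Lemma eqmodM b f f' g g' : eqmod b f f' -> eqmod b g g' ->
  eqmod b (f * g) (f' * g').
Proof.
move=> ff gg m mb; rewrite !coef_fpsM; apply: eq_bigr => k _.
by rewrite ff ?gg // (leq_trans (bmdeg _)).
Qed.

(** If [mdeg k + mdeg l < a + b], then [mdeg k < a] or [mdeg l < b]: orders of vanishing add up. *)
Lemma eqmodM0 a b f g : eqmod a f 0 -> eqmod b g 0 -> eqmod (a + b) (f * g) 0.
Proof.
move=> f0 g0 m mb; rewrite coef_fpsM coef_fps0 big1 // => -[k' l'] /=.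
move: (bmnm k') (bmnm l') => k l /eqP mE.
have [ka|ak] := ltnP (mdeg k) a; first by rewrite f0 // coef_fps0 mul0r.
rewrite g0 ?coef_fps0 ?mulr0 //.
by move: mb; rewrite mE mdegD; apply: contraTltn => bl; rewrite -leqNgt leq_add.
Qed.

Lemma eqmod_sum b (I : Type) (r : seq I) (P : pred I) (F G : I -> fps R n) :
  (forall i, P i -> eqmod b (F i) (G i)) ->
  eqmod b (\sum_(i <- r | P i) F i) (\sum_(i <- r | P i) G i).
Proof.
by move=> FG; apply: (big_ind2 (eqmod b)) => // *; apply: eqmodD.
Qed.

Lemma eqmod_prod b (I : Type) (r : seq I) (P : pred I) (F G : I -> fps R n) :
  (forall i, P i -> eqmod b (F i) (G i)) ->
  eqmod b (\prod_(i <- r | P i) F i) (\prod_(i <- r | P i) G i).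
Proof.
by move=> FG; apply: (big_ind2 (eqmod b)) => // *; apply: eqmodM.
Qed.

Lemma eqmodX b k f g : eqmod b f g -> eqmod b (f ^+ k) (g ^+ k).
Proof.
by move=> fg; elim: k => // k IH; rewrite !exprS; apply: eqmodM.
Qed.

Lemma eqmod_deriv b i f g : eqmod b.+1 f g -> eqmod b ('d_i f) ('d_i g).
Proof. by move=> fg m mb /=; rewrite fg // mdegD mdeg1 addn1. Qed.

Definition fps_mono a : fps R n := FPS (fun m => (m == a)%:R).

Lemma fps_monoM (a c : 'X_{1..n}) :
  fps_mono (a + c)%MM = fps_mono a * fps_mono c.
Proof.
apply/fpsP => m; rewrite (mul_fpsE (b := (mdeg m).+1)) //.
rewrite (mcoeffM_eq (p' := 'X_[a]) (q' := 'X_[c])).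
- by rewrite -mpolyXD mcoeffX eq_sym.
- by move=> k km; rewrite mcoeff_trunc // mcoeffX eq_sym.
- by move=> k km; rewrite mcoeff_trunc // mcoeffX eq_sym.
Qed.

Lemma fps_mono0 : fps_mono 0%MM = 1.
Proof. by apply/fpsP => m /=; case: eqP. Qed.

Lemma fps_monoE a : fps_mono a = \prod_(i < n) fpsX R i ^+ (a i).
Proof.
rewrite [in LHS](multinomUE_id a) (big_morph _ fps_monoM fps_mono0).
apply: eq_bigr => i _; elim: (a i) => [|k IH].
  by rewrite mulm0n fps_mono0.
by rewrite mulmS fps_monoM IH exprS.
Qed.

(** Modulo order [b] a series is a finite sum of monomials, so a property stable under the ring
    operations and under this congruence reaches all series. *)
Lemma fps_ind b (P : fps R n -> Prop) :
  (forall c, P (fpsC n c)) -> (forall i, P (fpsX R i)) ->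
  (forall f g, P f -> P g -> P (f + g)) ->
  (forall f g, P f -> P g -> P (f * g)) ->
  (forall f g, eqmod b f g -> P f -> P g) -> forall f, P f.
Proof.
move=> PC PX PD PM Peq f.
have Pmono a : P (fps_mono a).
  rewrite fps_monoE; apply: (big_ind P) => [||i _].
  - by have := PC 1; rewrite rmorph1.
  - by move=> g h; apply: PM.
  - elim: (a i) => [|k IH]; first by have := PC 1; rewrite rmorph1.
    by rewrite exprS; apply: PM.
apply: (Peq (\sum_(a : 'X_{1..n < b}) fpsC n (coef_fps f a) * fps_mono a)).
  move=> m mb; rewrite -(mcoeff_trunc f mb) /trunc_fps raddf_sum coef_fps_sum.
  apply: eq_bigr => a _.
  by rewrite coef_fpsCM /= mcoeffZ mcoeffX eq_sym.
apply: (big_ind P) => [||a _]; first by have := PC 0; rewrite rmorph0.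
  by move=> g h; apply: PD.
by apply: PM.
Qed.

End Congruence.

(** * Substitution of series without constant term, chain rule and Taylor estimate *)

Section Substitution.
Variables (R : comNzRingType) (n k : nat).
Implicit Types (f : fps R n) (g h : 'I_n -> fps R k) (b : nat).

(** Each factor has order at least 1. This is why [subst_fps] may cut off its sum: the omitted
    exponents contribute nothing. *)
Lemma eqmod_mmap1 g (a : 'X_{1..n}) : (forall i, eval0 (g i) = 0) ->
  eqmod (mdeg a) (mmap1 g a) 0.
Proof.
move=> g0; rewrite mdegE /mmap1.
apply: (big_ind2 (fun s x => eqmod s x 0)) => [|s x t y|i _] //.
  exact: eqmodM0.
elim: (a i) => // j IH; rewrite exprS -add1n; apply: eqmodM0 => //.
by apply/eqmod1P; rewrite g0 raddf0.
Qed.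

(** Up to order [b] substitution is the evaluation of a polynomial, from which it inherits its
    compatibility with products. *)
Lemma subst_mmap b f g (p : {mpoly R[n]}) : (forall i, eval0 (g i) = 0) ->
  (forall a, (mdeg a < b)%N -> coef_fps f a = p@_a) ->
  eqmod b (subst_fps f g) (mmap (fpsC k) g p).
Proof.
(* Both sums are widened to the exponents of degree below a common bound [c]; the terms of degree
   above [mdeg m] have coefficient 0 at [m]. *)
move=> g0 fp m mb; have [c [cb pc]] : exists c, (b <= c)%N /\ (msize p <= c)%N.
  by exists (maxn b (msize p)); rewrite leq_maxl leq_maxr.
rewrite (mmapE c) // coef_fps_sum /subst_fps [LHS]/=.
pose F (a : 'X_{1..n}) := coef_fps f a * coef_fps (mmap1 g a) m.
rewrite (big_sub_widen 'X_{1..n < (mdeg m).+1} 'X_{1..n < c} xpredT F);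
  last by move=> a am; apply: leq_trans am (leq_trans mb cb).
rewrite big_mkcond; apply: eq_bigr => a _.
rewrite -[RHS]/(coef_fps (fpsC k p@_a * mmap1 g a) m) coef_fpsCM.
rewrite andTb ltnS {}/F.
case: leqP => am; first by rewrite fp // (leq_ltn_trans am).
by rewrite eqmod_mmap1 // coef_fps0 mulr0.
Qed.

Lemma eqmod_subst b f f' g : eqmod b f f' ->
  eqmod b (subst_fps f g) (subst_fps f' g).
Proof.
move=> ff m mb; apply: eq_bigr => a _.
by rewrite ff // (leq_trans (bmdeg _)).
Qed.

Lemma eqmod_subst_r b f g h : (forall i, eqmod b (g i) (h i)) ->
  eqmod b (subst_fps f g) (subst_fps f h).
Proof.
move=> gh m mb; apply: eq_bigr => a _; congr (_ * _).
by apply: (@eqmod_prod _ _ b) mb => i _; apply: eqmodX.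
Qed.

Lemma eq_subst f g h : g =1 h -> subst_fps f g = subst_fps f h.
Proof. by move=> /funext ->. Qed.

Section Morphism.
Variables (g : 'I_n -> fps R k) (g0 : forall i, eval0 (g i) = 0).

(* The proof argument only serves to attach the ring morphism structure, which
   needs the g_i to have no constant term. *)
Definition subst_morph of (forall i, eval0 (g i) = 0) :=
  fun f => subst_fps f g.

Lemma subst_is_zmod_morphism : zmod_morphism (subst_morph g0).
Proof.
move=> f h; apply/fpsP => m; rewrite coef_fpsB -sumrB; apply: eq_bigr => a _.
by rewrite coef_fpsB mulrBl.
Qed.

HB.instance Definition _ := GRing.isZmodMorphism.Build (fps R n) (fps R k)
  (subst_morph g0) subst_is_zmod_morphism.

Lemma subst_fpsC c : subst_fps (fpsC n c) g = fpsC k c.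
Proof.
apply: eqmod_eq => b; rewrite -(mmapC g (fpsC k)); apply: subst_mmap => // a _.
by rewrite mcoeffC /=; case: eqP; rewrite ?mulr1 ?mulr0.
Qed.

Lemma subst_fpsX i : subst_fps (fpsX R i) g = g i.
Proof.
apply: eqmod_eq => b; rewrite -(mmap1U g) -(mmapX g (fpsC k)).
by apply: subst_mmap => // a _; rewrite mcoeffX eq_sym.
Qed.

Lemma subst_is_monoid_morphism : monoid_morphism (subst_morph g0).
Proof.
split=> [|f h]; first by rewrite /subst_morph (subst_fpsC 1) rmorph1.
apply: eqmod_eq => b; pose p (h : fps R n) := trunc_fps b h.
have pE (h' : fps R n) a : (mdeg a < b)%N -> coef_fps h' a = (p h')@_a.
  by move=> ab; rewrite mcoeff_trunc.
apply: (@eqmod_trans _ _ _ (mmap (fpsC k) g (p f * p h))).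
  by apply: subst_mmap => // a ab; apply: mul_fpsE.
rewrite rmorphM; apply: eqmodM; apply: eqmod_sym; apply: subst_mmap => // a ab;
  exact: pE.
Qed.

HB.instance Definition _ := GRing.isMonoidMorphism.Build (fps R n) (fps R k)
  (subst_morph g0) subst_is_monoid_morphism.

Lemma substD (f h : fps R n) :
  subst_fps (f + h) g = subst_fps f g + subst_fps h g.
Proof. exact: (rmorphD (subst_morph g0)). Qed.

Lemma substM (f h : fps R n) :
  subst_fps (f * h) g = subst_fps f g * subst_fps h g.
Proof. exact: (rmorphM (subst_morph g0)). Qed.

Lemma substB (f h : fps R n) :
  subst_fps (f - h) g = subst_fps f g - subst_fps h g.
Proof. exact: (rmorphB (subst_morph g0)). Qed.

Lemma subst1 : subst_fps 1 g = 1.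
Proof. exact: (rmorph1 (subst_morph g0)). Qed.

Lemma subst0 : subst_fps 0 g = 0.
Proof. exact: (rmorph0 (subst_morph g0)). Qed.

Lemma substZ c f : subst_fps (c *: f) g = c *: subst_fps f g.
Proof. by rewrite !scale_fpsE substM subst_fpsC. Qed.

Lemma eval0_subst f : eval0 (subst_fps f g) = eval0 f.
Proof.
suff /eqmod1P -> : eqmod 1 (subst_fps f g) (fpsC k (eval0 f)) by rewrite eval0C.
rewrite -subst_fpsC; apply: eqmod_subst; apply/eqmod1P; by rewrite eval0C.
Qed.

Lemma deriv_subst l f :
  'd_l (subst_fps f g) = \sum_i subst_fps ('d_i f) g * 'd_l (g i).
Proof.
(* The induction uses one order more than the goal, since derivation loses one in the congruence
   case. *)
apply: eqmod_eq => b; elim/(@fps_ind R n b.+1): f => [c|i|f h Pf Ph|f h Pf Ph|].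
- rewrite subst_fpsC derivC big1 // => i _.
  by rewrite derivC subst0 mul0r.
- rewrite subst_fpsX (bigD1 i) //= derivX eqxx mulr1n subst1 mul1r.
  rewrite big1 ?addr0 // => j ji.
  by rewrite derivX (negbTE ji) subst0 mul0r.
- rewrite substD raddfD /=; under eq_bigr do rewrite raddfD substD mulrDl.
  by rewrite big_split; apply: eqmodD.
- rewrite substM derivM; under eq_bigr do rewrite derivM substD !substM mulrDl.
  rewrite big_split; apply: eqmodD.
    under eq_bigr do rewrite mulrAC.
    by rewrite -mulr_suml; apply: eqmodM.
  under eq_bigr do rewrite -mulrA.
  by rewrite -mulr_sumr; apply: eqmodM.
- move=> f h fh Pf; apply: (eqmod_trans _ (eqmod_trans Pf _)).
    by apply: eqmod_deriv; apply: eqmod_subst; apply: eqmod_sym.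
  apply: eqmod_sum => i _; apply: eqmodM => //.
  by apply: eqmod_subst; apply: eqmod_deriv.
Qed.

End Morphism.
End Substitution.

Lemma subst_comp (R : comNzRingType) (n k l : nat) (f : fps R n)
    (g : 'I_n -> fps R k) (h : 'I_k -> fps R l) :
  (forall i, eval0 (g i) = 0) -> (forall i, eval0 (h i) = 0) ->
  subst_fps (subst_fps f g) h = subst_fps f (fun i => subst_fps (g i) h).
Proof.
move=> g0 h0; have gh0 i : eval0 (subst_fps (g i) h) = 0.
  by rewrite eval0_subst.
apply: eqmod_eq => b.
elim/(@fps_ind R n b): f => [c|i|f f' Pf Pf'|f f' Pf Pf'|].
- by rewrite !subst_fpsC.
- by rewrite !subst_fpsX.
- by rewrite !substD //; apply: eqmodD.
- by rewrite !substM //; apply: eqmodM.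
- move=> f f' ff Pf; apply: (eqmod_trans _ (eqmod_trans Pf _)).
    by do 2!apply: eqmod_subst; apply: eqmod_sym.
  exact: eqmod_subst.
Qed.

(** First-order Taylor formula at 0: as [u - v] has order [b] and [u], [v] have no constant term,
    all nonlinear terms have order at least [b.+1]. *)
Lemma eqmod_substB (R : comNzRingType) (n k b : nat) (f : fps R n)
    (u v : 'I_n -> fps R k) :
  (forall i, eval0 (u i) = 0) -> (forall i, eval0 (v i) = 0) ->
  (0 < b)%N -> (forall i, eqmod b (u i) (v i)) ->
  eqmod b.+1 (subst_fps f u - subst_fps f v)
    (\sum_i eval0 ('d_i f) *: (u i - v i)).
Proof.
move=> u0 v0 b0 uv; elim/(@fps_ind R n b.+1): f => [c|i|f g Pf Pg|f g Pf Pg|].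
- rewrite !subst_fpsC // subrr big1 // => i _.
  by rewrite derivC raddf0 scale0r.
- rewrite !subst_fpsX // (bigD1 i) //= derivX eqxx rmorph1 scale1r.
  rewrite big1 ?addr0 // => j ji.
  by rewrite derivX (negbTE ji) raddf0 scale0r.
- rewrite !substD // opprD addrACA.
  under eq_bigr do rewrite derivD eval0D scalerDl.
  by rewrite big_split; apply: eqmodD.
- have fE : \sum_i eval0 ('d_i (f * g)) *: (u i - v i)
      = (\sum_i eval0 ('d_i f) *: (u i - v i)) * fpsC k (eval0 g)
        + fpsC k (eval0 f) * (\sum_i eval0 ('d_i g) *: (u i - v i)).
    rewrite mulr_suml mulr_sumr -big_split; apply: eq_bigr => i _.
    rewrite derivM eval0D !eval0M scalerDl !scale_fpsE !rmorphM /=.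
    by rewrite [X in X + _]mulrAC !mulrA.
  have -> : subst_fps (f * g) u - subst_fps (f * g) v
      = (subst_fps f u - subst_fps f v) * subst_fps g u
        + subst_fps f v * (subst_fps g u - subst_fps g v).
    by rewrite !substM // mulrBl mulrBr addrA subrK.
  (* Increments have order [b] and deviations from the constant term order 1, so freezing the other
     factor at its value at 0 is exact up to order [b + 1]. *)
  have B0 (h : fps R n) : eqmod b (subst_fps h u - subst_fps h v) 0.
    by apply/eqmod_subr0; apply: eqmod_subst_r.
  have C0 (h : fps R n) w : (forall i, eval0 (w i) = 0) ->
      eqmod 1 (subst_fps h w - fpsC k (eval0 h)) 0.
    move=> w0; apply/eqmod1P.
    by rewrite raddfB /= eval0C eval0_subst // subrr raddf0.
  rewrite {}fE; apply: eqmodD.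
    apply: (@eqmod_trans _ _ _
      ((subst_fps f u - subst_fps f v) * fpsC k (eval0 g))).
      apply/eqmod_subr0; rewrite -mulrBr -addn1.
      by apply: eqmodM0; [apply: B0 | apply: C0].
    exact: eqmodM.
  apply: (@eqmod_trans _ _ _
    (fpsC k (eval0 f) * (subst_fps g u - subst_fps g v))).
    apply/eqmod_subr0; rewrite -mulrBl -add1n.
    by apply: eqmodM0; [apply: C0 | apply: B0].
  exact: eqmodM.
- move=> f g fg Pf; apply: (eqmod_trans _ (eqmod_trans Pf _)).
    by apply: eqmodB; apply: eqmod_subst; apply: eqmod_sym.
  apply: eqmod_sum => i _; rewrite (_ : eval0 _ = eval0 ('d_i g)) //.
  by apply/eqmod1P/eqmod_deriv; apply: eqmod_le fg; rewrite !ltnS.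
Qed.

(** * A formal implicit function theorem *)

Section ImplicitFunction.
Variables (R : comNzRingType) (q d p : nat).
Variables (rho : 'I_d -> fps R q) (L : 'M[R]_(p, q)) (K : 'M[R]_(d, q)).
Hypothesis rho0 : forall j, eval0 (rho j) = 0.
Hypothesis KJ : K *m (\matrix_(i, j) eval0 ('d_i (rho j))) = 1%:M.

(** In row vectors this is the point t L + s K: [L] carries the free parameters, and the rows of
    [K], dual to the differentials of the [rho j] at 0, the corrections. *)
Let param (s : 'I_d -> fps R p) (i : 'I_q) : fps R p :=
  \sum_l L l i *: fpsX R l + \sum_j K j i *: s j.

(* Newton's iteration for rho (param s) = 0, with the derivative frozen at 0,
   where it is the identity by KJ. *)
Let newton (s : 'I_d -> fps R p) (j : 'I_d) : fps R p :=
  s j - subst_fps (rho j) (param s).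

Let param0 s : (forall j, eval0 (s j) = 0) -> forall i, eval0 (param s i) = 0.
Proof.
move=> s0 i; rewrite /param raddfD !raddf_sum /= !big1 ?addr0 // => j _.
  by rewrite eval0Z s0 mulr0.
by rewrite eval0Z eval0X mulr0.
Qed.

Let newton0 s : (forall j, eval0 (s j) = 0) -> forall j, eval0 (newton s j) = 0.
Proof.
move=> s0 j; rewrite /newton raddfB /= eval0_subst; last exact: param0.
by rewrite s0 rho0 subrr.
Qed.

(** By [KJ] the linear part of rho (param s) - rho (param s') is exactly s - s', which [newton]
    cancels; by [eqmod_substB] the remainder has order [b.+1]. *)
Let newton_contract b s s' :
  (forall j, eval0 (s j) = 0) -> (forall j, eval0 (s' j) = 0) -> (0 < b)%N ->
  (forall j, eqmod b (s j) (s' j)) ->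
  forall j, eqmod b.+1 (newton s j) (newton s' j).
Proof.
move=> s0 s0' b0 ss' j; apply/eqmod_subr0.
have dE i : param s i - param s' i = \sum_l K l i *: (s l - s' l).
  rewrite opprD addrACA subrr add0r -sumrB.
  by apply: eq_bigr => l _; rewrite scalerBr.
have -> : newton s j - newton s' j = (s j - s' j)
    - (subst_fps (rho j) (param s) - subst_fps (rho j) (param s')).
  by rewrite /newton !opprD !opprK addrACA.
have sE : s j - s' j
    = \sum_i eval0 ('d_i (rho j)) *: (param s i - param s' i).
  transitivity (\sum_l (K *m (\matrix_(i, j) eval0 ('d_i (rho j)))) l j
      *: (s l - s' l)).
    rewrite KJ (bigD1 j) //= mxE eqxx scale1r big1 ?addr0 // => l lj.
    by rewrite mxE (negbTE lj) scale0r.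
  under [RHS]eq_bigr do rewrite dE scaler_sumr.
  rewrite [RHS]exchange_big; apply: eq_bigr => l _; rewrite mxE scaler_suml.
  by apply: eq_bigr => i _; rewrite scalerA mxE mulrC.
apply/eqmod_subr0; rewrite [in X in eqmod _ X _]sE; apply: eqmod_sym.
apply: eqmod_substB => //; try exact: param0.
move=> i; apply/eqmod_subr0; rewrite dE.
apply: (big_ind (fun x => eqmod b x 0)) => // [x y x0 y0|l _].
  by rewrite -(addr0 0); apply: eqmodD.
rewrite scale_fpsE -(mulr0 (fpsC p (K l i))).
by apply: eqmodM => //; apply/eqmod_subr0.
Qed.

Let approx k : 'I_d -> fps R p := iter k newton (fun=> 0).

Let approx0 k j : eval0 (approx k j) = 0.
Proof. by elim: k j => [|k IH] j; [rewrite raddf0 | apply: newton0]. Qed.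

Let approxS k j : eqmod k.+1 (approx k j) (approx k.+1 j).
Proof.
elim: k j => [|k IH] j; first by apply/eqmod1P; rewrite !approx0.
by apply: (newton_contract (approx0 k) (approx0 k.+1)).
Qed.

Let approx_le a c j : (a <= c)%N -> eqmod a.+1 (approx a j) (approx c j).
Proof.
elim: c => [|c IH]; first by rewrite leqn0 => /eqP ->.
rewrite leq_eqVlt ltnS => /orP[/eqP -> //|ac].
by apply: eqmod_trans (IH ac) (eqmod_le _ (@approxS c j)).
Qed.

Lemma implicit_fps : exists s : 'I_d -> fps R p,
  let g i := \sum_l L l i *: fpsX R l + \sum_j K j i *: s j in
  [/\ forall j, eval0 (s j) = 0, forall i, eval0 (g i) = 0 &
      forall j, subst_fps (rho j) g = 0].
Proof.
(* The limit of the iteration: the coefficient at [m] no longer changes from iterate [mdeg m] on. *)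
pose s j : fps R p := FPS (fun m => coef_fps (approx (mdeg m) j) m).
have sE k j : eqmod k.+1 (s j) (approx k j).
  by move=> m; rewrite ltnS /s /= => mk; rewrite (approx_le _ mk).
have s0 j : eval0 (s j) = 0.
  by have /eqmod1P := sE 0%N j; rewrite approx0.
exists s; split => //; first exact: param0.
move=> j; suff : newton s j = s j.
  by move/eqP; rewrite /newton -subr_eq0 addrAC subrr add0r oppr_eq0 => /eqP.
(* Since [s] agrees with [approx b] to order [b.+1], contraction makes [newton s] agree with
   [approx b.+1], hence with [s], to order [b.+2]. *)
apply: eqmod_eq => b; apply: (@eqmod_le _ _ b b.+2).
  by rewrite -addn2 leq_addr.
apply: eqmod_trans (eqmod_sym (sE b.+1 j)).
by apply: (newton_contract s0 (approx0 b)) => // i; apply: sE.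
Qed.

End ImplicitFunction.

(** * Leading monomials, absence of zero divisors, and the Wronskian criterion *)

Section LeadingMonomial.
Variables (R : idomainType) (n : nat).
Implicit Types (f g : fps R n) (m : 'X_{1..n}).

(** The monomial order is well founded, so the support of a nonzero series has a least element. *)
Lemma fps_lead f : f != 0 ->
  exists2 m, coef_fps f m != 0 & forall k, (k < m)%O -> coef_fps f k = 0.
Proof.
move=> /eqP f0; apply: contrapT => nlead; apply: f0; apply/fpsP => m.
rewrite coef_fps0; elim/(@ltmwf n): m => m IH; apply/eqP/negPn/negP => fm.
by apply: nlead; exists m.
Qed.

(** Any other pair of exponents with sum [a + c] has its first member below [a] or its second below
    [c]. The coefficients at [a] and [c] may themselves vanish, which the Wronskian argument
    needs. *)
Lemma coef_fpsM_lead f g (a c : 'X_{1..n}) :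
  (forall k, (k < a)%O -> coef_fps f k = 0) ->
  (forall k, (k < c)%O -> coef_fps g k = 0) ->
  coef_fps (f * g) (a + c)%MM = coef_fps f a * coef_fps g c.
Proof.
move=> fa gc; have am : (mdeg a < (mdeg (a + c)).+1)%N.
  by rewrite ltnS mdegD leq_addr.
have cm : (mdeg c < (mdeg (a + c)).+1)%N by rewrite ltnS mdegD leq_addl.
rewrite coef_fpsM (bigD1 (BMultinom am, BMultinom cm)) //=.
rewrite big1 ?addr0 // => -[k l] /= /andP[/eqP kl ne].
have [ka|ak] := ltP (bmnm k) a; first by rewrite fa // mul0r.
have [lc|cl] := ltP (bmnm l) c; first by rewrite gc // mulr0.
have kE : bmnm k = a.
  apply/eqP; move: ak; rewrite eq_sym le_eqVlt => /orP[//|ak].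
  by have := ltmc_le_add ak cl; rewrite -kl ltxx.
have lE : bmnm l = c by move/eqP: kl; rewrite kE eqm_add2l => /eqP.
case/eqP: ne; congr (_, _); exact: val_inj.
Qed.

Lemma mul_fps_neq0 f g : f != 0 -> g != 0 -> f * g != 0.
Proof.
move=> /fps_lead[a fa fl] /fps_lead[c gc gl]; apply/eqP => fg0.
have := coef_fpsM_lead fl gl; rewrite fg0 coef_fps0 => /esym/eqP.
by rewrite mulf_eq0 (negbTE fa) (negbTE gc).
Qed.

Lemma mul_fps_eq0 f g : f != 0 -> f * g = 0 -> g = 0.
Proof.
by move=> f0 fg; apply/eqP/negPn/negP => /(mul_fps_neq0 f0); rewrite fg eqxx.
Qed.

(** The Euler operator is diagonal on monomials; unlike ['d_i] it creates no monomial below the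
    leading one. *)
Lemma coef_fpsXM i f m :
  coef_fps (fpsX R i * 'd_i f) m = coef_fps f m *+ m i.
Proof.
have [mi|mi] := posnP (m i).
  rewrite mi coef_fpsM big1 // => -[k' l'] /=.
  move: (bmnm k') (bmnm l') => k l /eqP mE.
  case: eqP => [kE|]; last by rewrite mul0r.
  by move: mi; rewrite mE kE mnmDE mnm1E eqxx.
have -> : m = (U_(i) + (m - U_(i)))%MM.
  rewrite addmC submK //; apply/mnm_lepP => j; rewrite mnm1E.
  by case: eqP => // <-.
set k := (m - _)%MM; rewrite (mul_fpsE (b := (mdeg (U_(i) + k)).+1)) //.
rewrite (mcoeffM_eq (p' := 'X_i)
  (q' := trunc_fps (mdeg (U_(i) + k)).+1 ('d_i f))) //.
  rewrite mulrC mcoeffMX mcoeff_trunc ?mdegD ?ltnS ?leq_addl //.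
  by rewrite coef_deriv addmC mnmDE mnm1E eqxx add1n.
by move=> l lm; rewrite mcoeff_trunc // mcoeffX eq_sym.
Qed.

End LeadingMonomial.

(* Comparing the coefficients of [h * X_i d_i g = g * X_i d_i h] at the product
   of the leading monomials of g and h shows that these monomials coincide. *)
Lemma fps_wronskian (F : numFieldType) (n : nat) (f g : fps F n) : g != 0 ->
  (forall i, f * 'd_i g = g * 'd_i f) -> exists c, f = c *: g.
Proof.
(* This constant cancels the coefficient of [h = f - c *: g] at the leading monomial of [g], so a
   nonzero [h] must have a different leading monomial. *)
move=> /fps_lead[m gm glead] fg; exists (coef_fps f m / coef_fps g m).
set c := _ / _; apply/eqP; rewrite -subr_eq0; apply/negPn/negP.
set h := f - _ => /fps_lead[k hk hlead].
have hm : coef_fps h m = 0 by rewrite coef_fpsB coef_fpsZ divfK // subrr.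
have hg i : h * 'd_i g = g * 'd_i h.
  by rewrite mulrBl raddfB /= mulrBr fg derivZ !scale_fpsE -mulrA mulrCA.
suff mk : m = k by rewrite -mk hm eqxx in hk.
apply/mnmP => i.
have : h * (fpsX F i * 'd_i g) = g * (fpsX F i * 'd_i h).
  by rewrite mulrCA hg mulrCA.
move=> /(congr1 (fun x => coef_fps x (k + m)%MM)).
rewrite coef_fpsM_lead //; last first.
  by move=> l lm; rewrite coef_fpsXM glead // mul0rn.
rewrite addmC coef_fpsM_lead //; last first.
  by move=> l lk; rewrite coef_fpsXM hlead // mul0rn.
rewrite !coef_fpsXM -[_ *+ m i]mulr_natr -[_ *+ k i]mulr_natr mulrCA.
move=> /(mulfI gm)/(mulfI hk)/eqP.
by rewrite eqr_nat => /eqP.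
Qed.

(** * Linear algebra over power series, and injectivity of substitution *)

Section LinearAlgebra.
Variables (F : idomainType) (r : nat).

(** The adjugate reduces the system to [\det A *: y = 0], without passing to fractions. *)
Lemma mulmx_det_inj m (y : 'rV[fps F r]_m) (A : 'M_m) :
  \det A != 0 -> y *m A = 0 -> y = 0.
Proof.
move=> A0 yA; apply/rowP => i; rewrite mxE; apply: (mul_fps_eq0 A0).
have /rowP/(_ i) : y *m A *m \adj A = 0 by rewrite yA mul0mx.
by rewrite -mulmxA mul_mx_adj mul_mx_scalar !mxE.
Qed.

Lemma det_fps_neq0 m (A : 'M[fps F r]_m) :
  map_mx (@eval0 F r) A = 1%:M -> \det A != 0.
Proof.
move=> A1; apply/eqP => /(congr1 (@eval0 F r)).
by rewrite -det_map_mx A1 det1 raddf0 => /eqP; rewrite oner_eq0.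
Qed.

Lemma map_eval0C m n (A : 'M[F]_(m, n)) :
  map_mx (@eval0 F r) (map_mx (fpsC r) A) = A.
Proof. by apply/matrixP => i j; rewrite !mxE eval0C. Qed.

(** At 0, [1 - J K] is the projection onto the left kernel of [J], so the hypothesis on [S] says
    that the rows of [X] generate this kernel at 0. By Cramer's rule they then generate the whole
    kernel up to a nonzero factor. *)
Lemma fps_ker_span p q d (X : 'M[fps F r]_(p, q)) (J : 'M[fps F r]_(q, d))
    (K : 'M[F]_(d, q)) (S : 'M[F]_(q, p)) (v : 'rV[fps F r]_q) :
  K *m map_mx (@eval0 F r) J = 1%:M ->
  S *m map_mx (@eval0 F r) X = 1%:M - map_mx (@eval0 F r) J *m K ->
  X *m J = 0 -> v *m J = 0 ->
  exists2 delta, delta != 0 & exists w, delta *: v = w *m X.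
Proof.
move=> KJ SX XJ vJ.
pose K' := map_mx (fpsC r) K; pose S' := map_mx (fpsC r) S.
(* W is the identity at 0, so \adj W inverts it up to a nonzero factor. *)
pose W := S' *m X + J *m K'.
have W0 : \det W != 0.
  apply: det_fps_neq0; rewrite map_mxD !map_mxM /= !map_eval0C SX.
  by rewrite subrK.
exists (\det W) => //; exists (v *m \adj W *m S').
have vE : \det W *: v = v *m \adj W *m S' *m X + v *m \adj W *m J *m K'.
  by rewrite -!mulmxA -!mulmxDr mul_adj_mx mul_mx_scalar.
(* Multiplying [vE] by [J] leaves only [y *m (K' *m J) = 0], where [K' *m J] is the identity at
   0. *)
suff y0 : v *m \adj W *m J = 0 by rewrite vE y0 mul0mx addr0.
apply: (@mulmx_det_inj _ _ (K' *m J)).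
  by apply: det_fps_neq0; rewrite map_mxM map_eval0C.
have := congr1 (mulmx^~ J) vE; rewrite /= -scalemxAl vJ scaler0 mulmxDl.
by rewrite -(mulmxA _ X) XJ mulmx0 add0r -!mulmxA.
Qed.

End LinearAlgebra.

(* The chain rule puts the partial derivatives of f in the kernel of the
   substitution as well, so all of them vanish at 0. *)
Lemma subst_fps_inj0 (F : numDomainType) (n p : nat) (g : 'I_n -> fps F p)
    (S : 'M[F]_(n, p)) (f : fps F n) :
  (forall i, eval0 (g i) = 0) ->
  S *m (\matrix_(k, i) eval0 ('d_k (g i))) = 1%:M ->
  subst_fps f g = 0 -> f = 0.
Proof.
move=> g0 Sg.
have deriv0 h i : subst_fps h g = 0 -> subst_fps ('d_i h) g = 0.
  move=> hg; pose G := \matrix_(k, i) 'd_k (g i).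
  pose y := \row_i subst_fps ('d_i h) g.
  suff /rowP/(_ i) : y = 0 by rewrite !mxE.
  apply: (@mulmx_det_inj _ _ _ _ (map_mx (fpsC p) S *m G)^T).
    rewrite det_tr; apply: det_fps_neq0; rewrite map_mxM map_eval0C /= -Sg.
    by congr (_ *m _); apply/matrixP => k l; rewrite !mxE.
  rewrite trmx_mul mulmxA [y *m _](_ : _ = 0) ?mul0mx //.
  apply/rowP => k; rewrite !mxE.
  transitivity ('d_k (subst_fps h g)); last by rewrite hg raddf0.
  by rewrite deriv_subst //; apply: eq_bigr => l _; rewrite !mxE.
move=> fg; apply/fpsP => m; rewrite coef_fps0.
(* The series varies in the induction: a coefficient of [f] is, up to a positive integer factor, one
   of lower degree of a derivative of [f]. *)
elim: {m}(mdeg m) {-2}m (erefl (mdeg m)) f fg => [|e IH] m me f fg.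
  have /eqP -> : m == 0%MM by rewrite -mdeg_eq0 me.
  by rewrite -[LHS](eval0_subst g0 f) fg raddf0.
have [i mi] : exists i, (0 < m i)%N.
  apply/existsP; apply: contraT; rewrite negb_exists => /forallP m0.
  move: me; rewrite mdegE big1 // => i _; apply/eqP.
  by rewrite -leqn0 leqNgt m0.
have mE : m = (m - U_(i) + U_(i))%MM.
  rewrite submK //; apply/mnm_lepP => j; rewrite mnm1E.
  by case: eqP => // <-.
have ke : mdeg (m - U_(i)) = e.
  by apply: succn_inj; rewrite -me [in RHS]mE mdegD mdeg1 addn1.
have /eqP := IH _ ke _ (deriv0 f i fg).
by rewrite coef_deriv -mE mulrn_eq0 /= => /eqP.
Qed.

(** * Formal vector fields and the Lie algebra they generate *)

Section VectorFields.
Variables (F : numClosedFieldType) (q : nat).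
Implicit Types (X Y : formal_vf F q) (f g : fps F q).

Lemma vf_appB X f g : vf_app X (f - g) = vf_app X f - vf_app X g.
Proof.
by rewrite -sumrB; apply: eq_bigr => i _; rewrite raddfB mulrBr.
Qed.

Lemma vf_appM X f g : vf_app X (f * g) = vf_app X f * g + f * vf_app X g.
Proof.
rewrite mulr_suml mulr_sumr -big_split; apply: eq_bigr => i _ /=.
by rewrite derivM mulrDr mulrA mulrCA.
Qed.

Lemma vf_app0l f : vf_app 0 f = 0.
Proof. by rewrite /vf_app big1 // => i _; rewrite mxE mul0r. Qed.

Lemma vf_appDl X Y f : vf_app (X + Y) f = vf_app X f + vf_app Y f.
Proof. by rewrite -big_split; apply: eq_bigr => i _; rewrite mxE mulrDl. Qed.

Lemma vf_appZl c X f : vf_app (c *: X) f = c * vf_app X f.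
Proof. by rewrite mulr_sumr; apply: eq_bigr => i _; rewrite mxE mulrA. Qed.

(** The second-order part is symmetric in [X] and [Y], as partial derivatives commute, so it drops
    out of the commutator. *)
Lemma vf_app_app X Y f : vf_app X (vf_app Y f) =
  \sum_i vf_app X (Y 0 i) * 'd_i f
  + \sum_i \sum_j X 0 i * Y 0 j * 'd_i ('d_j f).
Proof.
have dE i : X 0 i * 'd_i (vf_app Y f) = \sum_j X 0 i * 'd_i (Y 0 j) * 'd_j f
    + \sum_j X 0 i * Y 0 j * 'd_i ('d_j f).
  rewrite [vf_app Y f]/vf_app raddf_sum mulr_sumr -big_split.
  by apply: eq_bigr => j _; rewrite /= derivM mulrDr !mulrA.
rewrite [LHS](eq_bigr _ (fun i _ => dE i)) big_split; congr (_ + _).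
rewrite exchange_big; apply: eq_bigr => j _.
by rewrite [vf_app X _]/vf_app mulr_suml.
Qed.

Lemma vf_app_bracket X Y f :
  vf_app (lie_bracket X Y) f = vf_app X (vf_app Y f) - vf_app Y (vf_app X f).
Proof.
rewrite !vf_app_app opprD addrACA.
rewrite [X in _ = _ + X](_ : _ = 0) ?addr0.
  by rewrite -sumrB; apply: eq_bigr => i _; rewrite mxE mulrBl.
rewrite [X in _ - X]exchange_big; apply/eqP; rewrite subr_eq0; apply/eqP.
apply: eq_bigr => i _; apply: eq_bigr => j _.
by rewrite deriv_comm [X 0 i * _]mulrC.
Qed.

(* X kills the fraction a / b on the zero set of the kernel of phi. *)
Definition vf_kills p (phi : fps F q -> fps F p) (a b : fps F q) X :=
  (forall f, phi f = 0 -> phi (vf_app X f) = 0) /\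
  phi (vf_app X a * b - a * vf_app X b) = 0.

(** Fields that kill a / b form a Lie algebra. Stability of the kernel of [phi] is carried along so
    that one field can be applied to the relation of another. *)
Lemma lie_gen_kills p (phi : {rmorphism fps F q -> fps F p})
    (S : formal_vf F q -> Prop) (a b : fps F q) : phi b != 0 ->
  (forall X, S X -> vf_kills phi a b X) ->
  forall X, lie_gen S X -> vf_kills phi a b X.
Proof.
move=> b0 SX X; elim=> {X} [X /SX //||X Y _ [kX wX] _ [kY wY]|c X _ [kX wX]|
    X Y _ [kX wX] _ [kY wY]].
- by split=> [f _|]; rewrite !vf_app0l ?mul0r ?mulr0 ?subrr rmorph0.
- split=> [f f0|]; first by rewrite vf_appDl rmorphD kX // kY // addr0.
  by rewrite !vf_appDl mulrDl mulrDr opprD addrACA rmorphD wX wY addr0.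
- split=> [f f0|]; first by rewrite vf_appZl rmorphM kX // mulr0.
  by rewrite !vf_appZl mulrCA -mulrA -mulrBr rmorphM wX mulr0.
split=> [f f0|].
  rewrite vf_app_bracket rmorphB (kX _ (kY _ f0)) (kY _ (kX _ f0)).
  by rewrite subrr.
(* Subtracting the two differentiated relations leaves the mixed terms Xa Yb - Ya Xb, which become a
   combination of the original relations only after multiplication by b. *)
apply: (mul_fps_eq0 b0); have eXY := kX _ wY; have eYX := kY _ wX.
move: eXY eYX wX wY.
rewrite !vf_app_bracket !vf_appB !vf_appM !(rmorphB, rmorphD, rmorphM) /=.
set XYa := phi (vf_app X (vf_app Y a)); set XYb := phi (vf_app X (vf_app Y b)).
set YXa := phi (vf_app Y (vf_app X a)); set YXb := phi (vf_app Y (vf_app X b)).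
set Xa := phi (vf_app X a); set Xb := phi (vf_app X b).
set Ya := phi (vf_app Y a); set Yb := phi (vf_app Y b).
set A := phi a; set B := phi b => eXY eYX eX eY.
have -> : B * ((XYa - YXa) * B - A * (XYb - YXb))
    = B * ((XYa * B + Ya * Xb - (Xa * Yb + A * XYb))
           - (YXa * B + Xa * Yb - (Ya * Xb + A * YXb)))
      + ((Xa * B - A * Xb) * Yb - (Ya * B - A * Yb) * Xb) *+ 2 by ring.
by rewrite eXY eYX eX eY !mul0r !subrr mulr0 mul0rn addr0.
Qed.

End VectorFields.

(** [L] is a basis of the left kernel of [J], of dimension [q - d] because a left inverse forces
    rank [d]. *)
Lemma ker_param (F : fieldType) (q d : nat) (J : 'M[F]_(q, d)) (K : 'M_(d, q)) :
  K *m J = 1%:M -> exists L : 'M[F]_(q - d, q), L *m J = 0 /\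
    forall p (A : 'M_(p, q)), A *m J = 0 -> exists S, S *m L = A.
Proof.
move=> KJ; have rk : \rank (kermx J) = (q - d)%N.
  rewrite mxrank_ker; congr (_ - _)%N; apply/eqP.
  by apply/row_fullP; exists K.
case: (q - d)%N / rk; exists (row_base (kermx J)); split=> [|p A AJ].
  by apply/sub_kermxP; rewrite eq_row_base.
have /submxP[S ->] : (A <= row_base (kermx J))%MS.
  by rewrite eq_row_base; apply/sub_kermxP.
by exists S.
Qed.

(** * Conjugation of coefficients and the two blocks of variables *)

Section Conjugation.
Variables (C : numClosedFieldType) (n : nat).
Implicit Type f : fps C n.

Lemma deriv_conj i f : 'd_i (conj_fps f) = conj_fps ('d_i f).
Proof. by apply/fpsP => m; rewrite /= rmorphMn. Qed.

Lemma eval0_conj f : eval0 (conj_fps f) = (eval0 f)^*.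
Proof. by []. Qed.

Lemma conj_fps_eq0 f : conj_fps f = 0 -> f = 0.
Proof.
move=> cf; apply/fpsP => m; apply: (fmorph_inj (@Num.conj C)).
by rewrite coef_fps0 rmorph0 -(coef_fps0 C m) -cf.
Qed.

End Conjugation.

Lemma join_varsl (T : Type) n (u v : 'I_n -> T) j :
  join_vars u v (lshift n j) = u j.
Proof. by rewrite /join_vars (unsplitK (inl _ j)). Qed.

Lemma join_varsr (T : Type) n (u v : 'I_n -> T) j :
  join_vars u v (rshift n j) = v j.
Proof. by rewrite /join_vars (unsplitK (inr _ j)). Qed.

Lemma join_varsE (T : Type) n (w : 'I_(n + n) -> T) :
  join_vars (fun j => w (lshift n j)) (fun j => w (rshift n j)) =1 w.
Proof. by move=> i; rewrite /join_vars; case: split_ordP => j ->. Qed.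

Lemma vf_app_subst (C : numClosedFieldType) (q p : nat) (X : formal_vf C q)
    (f : fps C p) (g : 'I_p -> fps C q) : (forall i, eval0 (g i) = 0) ->
  vf_app X (subst_fps f g) = \sum_i subst_fps ('d_i f) g * vf_app X (g i).
Proof.
move=> g0; rewrite /vf_app; under eq_bigr do rewrite deriv_subst // mulr_sumr.
rewrite exchange_big; apply: eq_bigr => i _; rewrite mulr_sumr.
by apply: eq_bigr => j _; rewrite mulrCA.
Qed.

Lemma vf_appX (C : numClosedFieldType) (q : nat) (X : formal_vf C q) i :
  vf_app X (fpsX C i) = X 0 i.
Proof.
rewrite /vf_app (bigD1 i) //= derivX eqxx mulr1 big1 ?addr0 // => j ji.
by rewrite derivX (negbTE ji) mulr0.
Qed.

(** * Jacobian and formal parametrization of a generic submanifold *)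

Section GenericSubmanifold.
Variables (C : numClosedFieldType) (n d : nat).
Variable M : formal_generic_submanifold C n d.
Local Notation q := (n + n)%N.
Local Notation rho := (defining M).

(** Rows are indexed by variables, so that tangent vectors at 0 are the row vectors in the left
    kernel. *)
Definition jacobian0 : 'M[C]_(n + n, d) := \matrix_(i, j) eval0 ('d_i (rho j)).

Lemma jacobian0_Z : exists B, B *m usubmx jacobian0 = 1%:M.
Proof.
have /row_freeP[B AB] := defining_free M; exists B^T.
rewrite -[RHS]trmx1 -AB trmx_mul; congr (_ *m _).
by apply/matrixP => i j; rewrite !mxE.
Qed.

(** Differentiate the reality condition in zeta_k: the chain rule keeps only the derivative of the
    conjugate series in its k-th Z-variable. *)
Lemma jacobian0_conj :
  dsubmx jacobian0 = map_mx (@Num.conj C) (usubmx jacobian0).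
Proof.
apply/matrixP => k j; rewrite !mxE.
have jv0 i : eval0 (join_vars (@zetavar C n) (@Zvar C n) i) = 0.
  by rewrite /join_vars; case: split => l; apply: eval0X.
rewrite -{1}(defining_real M j) deriv_subst // raddf_sum /=.
rewrite (bigD1 (lshift n k)) //= join_varsl derivX eqxx mulr1.
rewrite eval0_subst // deriv_conj eval0_conj big1 ?addr0 // => i ik.
case: (split_ordP i) ik => l -> lk; rewrite ?join_varsl ?join_varsr derivX.
  rewrite (inj_eq (@rshift_inj n n)) eq_sym.
  by rewrite -(inj_eq (@lshift_inj n n)) (negbTE lk) mulr0 raddf0.
by rewrite eq_rlshift mulr0 raddf0.
Qed.

Lemma jacobian0_zeta : exists B, B *m dsubmx jacobian0 = 1%:M.
Proof.
have [B BJ] := jacobian0_Z; exists (map_mx (@Num.conj C) B).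
by rewrite jacobian0_conj -map_mxM BJ map_mx1.
Qed.

Lemma formal_param : exists gamma : 'I_(n + n) -> fps C (n + n - d),
  let G0 := \matrix_(k, i) eval0 ('d_k (gamma i)) in
  [/\ forall i, eval0 (gamma i) = 0,
      forall j, subst_fps (rho j) gamma = 0 &
      forall p (A : 'M[C]_(p, n + n)), A *m jacobian0 = 0 ->
        exists S, S *m G0 = A].
Proof.
(* Genericity provides a left inverse of the whole Jacobian that uses only the Z-derivatives. *)
have [B BJ] := jacobian0_Z; pose K := row_mx B (0 : 'M_(d, n)).
have KJ : K *m jacobian0 = 1%:M.
  by rewrite -[jacobian0]vsubmxK mul_row_col mul0mx addr0.
have [L [LJ Lker]] := ker_param KJ.
have [s [s0 g0 rg]] := implicit_fps L (defining0 M) KJ.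
set gamma := (fun i => _) in g0 rg; exists gamma; split=> //.
(* Differentiating [rho j] along [gamma] gives (L + S' K) J = 0; as L J = 0 and K J = 1, the
   correction [s] has zero differential [S'] at 0. *)
suff -> : \matrix_(k, i) eval0 ('d_k (gamma i)) = L by [].
pose S' : 'M[C]_(n + n - d, d) := \matrix_(k, j) eval0 ('d_k (s j)).
have GE : \matrix_(k, i) eval0 ('d_k (gamma i)) = L + S' *m K.
  apply/matrixP => k i; rewrite !mxE raddfD raddfD /=; congr (_ + _).
    rewrite !raddf_sum (bigD1 k) //= derivZ eval0Z derivX eqxx rmorph1 mulr1.
    rewrite big1 ?addr0 // => l lk.
    by rewrite derivZ eval0Z derivX eq_sym (negbTE lk) raddf0 mulr0.
  rewrite !raddf_sum; apply: eq_bigr => j _.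
  by rewrite /= derivZ eval0Z mulrC [S' k j]mxE.
have GJ : \matrix_(k, i) eval0 ('d_k (gamma i)) *m jacobian0 = 0.
  apply/matrixP => k j; rewrite !mxE.
  transitivity (eval0 ('d_k (subst_fps (rho j) gamma))); last first.
    by rewrite rg !raddf0.
  rewrite deriv_subst // raddf_sum; apply: eq_bigr => i _.
  by rewrite /= eval0M eval0_subst // !mxE mulrC.
suff S0 : S' = 0 by rewrite GE S0 mul0mx addr0.
by rewrite -[S']mulmx1 -KJ mulmxA -[_ *m jacobian0]add0r -[X in X + _]LJ
  -mulmxDl -GE.
Qed.

End GenericSubmanifold.

(** * The constancy theorem over any [numClosedFieldType] *)

Theorem formal_meromorphic_constant (C : numClosedFieldType) (n d m : nat)
    (M : formal_generic_submanifold C n d)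
    (E : formal_totally_real_manifold C m)
    (H : formal_meromorphic_map C n m) :
  finite_type M -> maps_into M E H ->
  exists c : 'I_m -> C, forall j : 'I_m, mnumer H j = c j *: mdenom H.
Proof.
move=> ftM MEH; apply: (@fin_all_exists _ (fun=> C)
  (fun j c => mnumer H j = c *: mdenom H)) => j.
have [gamma [g0 rg Gker]] := formal_param M.
pose phi : {rmorphism fps C (n + n) -> fps C (n + n - d)} := subst_morph g0.
have phiE f : phi f = subst_fps f gamma by [].
pose gamma1 i := gamma (lshift n i); pose gamma2 i := gamma (rshift n i).
have ideal0 f : manifold_ideal M f -> phi f = 0.
  move=> [a ->]; rewrite rmorph_sum big1 // => l _.
  by rewrite rmorphM [X in _ * X]rg mulr0.
pose iota1 f := subst_fps f (@Zvar C n).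
pose iota2 f := subst_fps f (@zetavar C n).
have Z0 i : eval0 (@Zvar C n i) = 0 by apply: eval0X.
have zeta0 i : eval0 (@zetavar C n i) = 0 by apply: eval0X.
have phi1 f : phi (iota1 f) = subst_fps f gamma1.
  rewrite phiE subst_comp //.
  by apply: eq_subst => i; rewrite subst_fpsX.
have phi2 f : phi (iota2 f) = subst_fps f gamma2.
  rewrite phiE subst_comp //.
  by apply: eq_subst => i; rewrite subst_fpsX.
(* Every z completes to a tangent vector at 0 with zeta-part - z J_Z B, where B inverts the
   zeta-block on the left; hence [gamma1] has a differential of rank n at 0. *)
have inj1 f : phi (iota1 f) = 0 -> f = 0.
  have [B BJ] := jacobian0_zeta M.
  have [|S SG] := Gker _ (row_mx 1%:M (- usubmx (jacobian0 M) *m B)).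
    by rewrite -[X in _ *m X]vsubmxK mul_row_col mul1mx -mulmxA BJ mulmx1 subrr.
  rewrite phi1; apply: (@subst_fps_inj0 _ _ _ _ S) => [i|]; first exact: g0.
  have := congr1 lsubmx SG; rewrite row_mxKl -mulmx_lsub => <-.
  by congr (_ *m _); apply/matrixP => k i; rewrite !mxE.
have inj2 f : phi (iota2 f) = 0 -> f = 0.
  have [B BJ] := jacobian0_Z M.
  have [|S SG] := Gker _ (row_mx (- dsubmx (jacobian0 M) *m B) 1%:M).
    rewrite -[X in _ *m X]vsubmxK mul_row_col mul1mx -mulmxA BJ mulmx1.
    by rewrite addNr.
  rewrite phi2; apply: (@subst_fps_inj0 _ _ _ _ S) => [i|]; first exact: g0.
  have := congr1 rsubmx SG; rewrite row_mxKr -mulmx_rsub => <-.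
  by congr (_ *m _); apply/matrixP => k i; rewrite !mxE.
pose a := iota1 (mnumer H j); pose b := iota1 (mdenom H).
pose a' := iota2 (conj_fps (mnumer H j)).
pose b' := iota2 (conj_fps (mdenom H)).
have b0 : phi b != 0 by apply: contra (mdenom_neq0 H) => /eqP/inj1 ->.
have b'0 : phi b' != 0.
  by apply: contra (mdenom_neq0 H) => /eqP/inj2/conj_fps_eq0 ->.
have ab : phi (a * b' - a' * b) = 0.
  rewrite rmorphB !rmorphM /= !phi1 !phi2.
  apply: (MEH gamma1 gamma2) => [i|i|f If]; try exact: g0.
  by rewrite (eq_subst _ (join_varsE gamma)) -[LHS]/(phi f) ideal0.
pose J := \matrix_(i, l) phi ('d_i (defining M l)).
pose G := \matrix_(k, i) 'd_k (gamma i).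
pose grad f := \col_i phi ('d_i f).
have gradE f : G *m grad f = \col_k 'd_k (phi f).
  apply/matrixP => k u; rewrite phiE !mxE deriv_subst //.
  by apply: eq_bigr => i _; rewrite !mxE mulrC.
have vfE X f : phi (vf_app X f) = (map_mx phi X *m grad f) 0 0.
  rewrite rmorph_sum mxE; apply: eq_bigr => i _.
  by rewrite rmorphM !mxE.
have gradJ l i k : grad (defining M l) i k = J i l by rewrite !mxE.
have GJ : G *m J = 0.
  apply/matrixP => k l; rewrite [RHS]mxE.
  transitivity ((G *m grad (defining M l)) k 0).
    by rewrite !mxE; apply: eq_bigr => i _; rewrite gradJ.
  by rewrite gradE mxE phiE rg raddf0.
have evJ : map_mx (@eval0 C _) J = jacobian0 M.
  by apply/matrixP => i l; rewrite !mxE; apply: eval0_subst.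
have vfJ X : (forall l, phi (vf_app X (defining M l)) = 0) ->
    map_mx phi X *m J = 0.
  move=> XJ; apply/matrixP => u l; rewrite ord1 [RHS]mxE -(XJ l) vfE !mxE.
  by apply: eq_bigr => i _; rewrite gradJ.
have [B BJ] := jacobian0_Z M; pose K := row_mx B (0 : 'M_(d, n)).
have KJ0 : K *m jacobian0 M = 1%:M.
  by rewrite -[jacobian0 M]vsubmxK mul_row_col mul0mx addr0.
have PJ : (1%:M - jacobian0 M *m K) *m jacobian0 M = 0.
  by rewrite mulmxBl mul1mx -mulmxA KJ0 mulmx1 subrr.
have KJ : K *m map_mx (@eval0 C _) J = 1%:M by rewrite evJ.
(* Tangency is given on the manifold ideal only. Along [gamma], [X] kills the defining series, so a
   nonzero multiple of it is a combination of the d gamma / dt_k, and these differentiate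
   [phi f = 0] to 0. *)
have tangent_ker X : tangent_vf M X ->
    forall f, phi f = 0 -> phi (vf_app X f) = 0.
  move=> tX f f0; have [S SG] := Gker _ _ PJ.
  have XJ : map_mx phi X *m J = 0.
    apply: vfJ => l; apply/ideal0/tX.
    exists (fun i => (i == l)%:R); rewrite (bigD1 l) //= eqxx mul1r.
    by rewrite big1 ?addr0 // => i il; rewrite (negbTE il) mul0r.
  have SG' : S *m map_mx (@eval0 C _) G = 1%:M - map_mx (@eval0 C _) J *m K.
    by rewrite evJ -SG; congr (_ *m _); apply/matrixP => k i; rewrite !mxE.
  have [delta delta0 [w Xw]] := fps_ker_span KJ SG' GJ XJ.
  apply: (mul_fps_eq0 delta0).
  have -> : delta * phi (vf_app X f) = (delta *: map_mx phi X *m grad f) 0 0.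
    by rewrite vfE -scalemxAl [RHS]mxE.
  rewrite Xw -mulmxA gradE mxE big1 // => k _.
  by rewrite [X in _ * X]mxE f0 raddf0 mulr0.
pose S X := (vf10 X \/ vf01 X) /\ tangent_vf M X.
have killsS X : S X -> vf_kills phi a b X.
  move=> [Xtype tX]; split; first exact: tangent_ker.
  case: Xtype => [X10|X01]; last first.
    have X0 f : vf_app X (iota1 f) = 0.
      rewrite vf_app_subst // big1 // => i _.
      by rewrite vf_appX X01 mulr0.
    by rewrite !X0 mul0r mulr0 subrr rmorph0.
  have X0 f : vf_app X (iota2 f) = 0.
    rewrite vf_app_subst // big1 // => i _.
    by rewrite vf_appX X10 mulr0.
  (* For a (1,0)-field, differentiating the relation [ab] gives Xa b' = a' Xb under [phi]; the
     factor b' then allows a b' to be exchanged with a' b. *)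
  apply: (mul_fps_eq0 b'0).
  have := tangent_ker X tX _ ab.
  rewrite vf_appB !vf_appM !X0 mulr0 mul0r add0r addr0.
  move: ab; rewrite !rmorphB !rmorphM /=.
  set A := phi a; set B' := phi b; set A' := phi a'; set D' := phi b'.
  set Xa := phi (vf_app X a); set Xb := phi (vf_app X b) => ab Xab.
  have -> : D' * (Xa * B' - A * Xb)
      = B' * (Xa * D' - A' * Xb) - Xb * (A * D' - A' * B') by ring.
  by rewrite ab Xab !mulr0 subrr.
have killsg := lie_gen_kills b0 killsS.
pose gS := lie_gen S.
(* The Lie algebra is closed under complex linear combinations, so a vector in the span of its
   values at 0 is the value of a single field. *)
have gspan v : v *m jacobian0 M = 0 -> exists2 X, gS X & v = vf_at0 X.
  move=> vJ; have /(ftM v) [s sS vs] : complex_tangent_space M v.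
    move=> l; have /rowP/(_ l) := vJ; rewrite !mxE => vl.
    by rewrite -[RHS]vl; apply: eq_bigr => i _; rewrite mxE.
  rewrite (coord_span (X := in_tuple s) vs).
  apply: (big_ind (fun u => exists2 X, gS X & u = vf_at0 X)) => [|v1 v2|i _].
  - by exists 0; [apply: lie_gen_zero | apply/rowP => i; rewrite !mxE raddf0].
  - move=> [X gX ->] [Y gY ->]; exists (X + Y); first exact: lie_gen_add.
    by apply/rowP => i; rewrite !mxE raddfD.
  - have [X gX ->] := sS _ (mem_nth 0 (ltn_ord i)).
    exists (fpsC _ (coord (in_tuple s) i v) *: X); first exact: lie_gen_scale.
    by apply/rowP => k; rewrite !mxE -scale_fpsE eval0Z.
(* The rows of this projection span the tangent space at 0; lifting all of them, rather than a
   basis, lets [fps_ker_span] apply with [S] the identity. *)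
have /fin_all_exists[Xs XsP] i : exists X,
    gS X /\ row i (1%:M - jacobian0 M *m K) = vf_at0 X.
  have [|X gX vX] := gspan (row i (1%:M - jacobian0 M *m K)); last by exists X.
  by rewrite -row_mul PJ row0.
pose X := \matrix_i map_mx phi (Xs i).
have XJ : X *m J = 0.
  apply/row_matrixP => i; rewrite row_mul rowK row0; apply: vfJ => l.
  by have [kX _] := killsg _ (XsP i).1; apply: kX; apply: rg.
have evX : 1%:M *m map_mx (@eval0 C _) X = 1%:M - map_mx (@eval0 C _) J *m K.
  rewrite mul1mx evJ; apply/row_matrixP => i; rewrite (XsP i).2.
  by apply/rowP => k; rewrite !mxE; apply: eval0_subst.
(* The row d gamma / dt_i lies in the left kernel of [J], so a nonzero multiple of it is a
   combination of the fields [Xs] along [gamma], each of which kills a / b. *)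
have ratio i : phi a * 'd_i (phi b) = phi b * 'd_i (phi a).
  have rowGJ : row i G *m J = 0 by rewrite -row_mul GJ row0.
  have [delta delta0 [w Gw]] := fps_ker_span KJ evX XJ rowGJ.
  have dE f : delta * 'd_i (phi f) = \sum_k w 0 k * phi (vf_app (Xs k) f).
    have -> : delta * 'd_i (phi f) = (delta *: row i G *m grad f) 0 0.
      by rewrite -scalemxAl [RHS]mxE -row_mul gradE !mxE.
    rewrite Gw -mulmxA mxE; apply: eq_bigr => k _; congr (_ * _).
    by rewrite vfE -(rowK (fun k => map_mx phi (Xs k)) k) -row_mul [RHS]mxE.
  apply/eqP; rewrite eq_sym -subr_eq0; apply/eqP; apply: (mul_fps_eq0 delta0).
  rewrite mulrBr mulrCA dE [X in _ - X]mulrCA dE !mulr_sumr -sumrB.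
  rewrite big1 // => k _.
  have [_ /eqP] := killsg _ (XsP k).1.
  rewrite rmorphB !rmorphM subr_eq0 /= => /eqP e.
  by rewrite mulrCA [phi b * _]mulrC e [phi a * (_ * _)]mulrCA subrr.
have [c cE] := fps_wronskian b0 ratio.
exists c; apply/eqP; rewrite -subr_eq0; apply/eqP; apply: inj1.
have gamma10 i : eval0 (gamma1 i) = 0 by apply: g0.
by rewrite phi1 substB // substZ // -!phi1 [phi (iota1 (mnumer H j))]cE subrr.
Qed.

Theorem theorem2 (R : realType) (n d m : nat)
    (M : formal_generic_submanifold R[i] n d)
    (E : formal_totally_real_manifold R[i] m)
    (H : formal_meromorphic_map R[i] n m) :
  finite_type M -> maps_into M E H ->
  exists c : 'I_m -> R[i], forall j : 'I_m, mnumer H j = c j *: mdenom H.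
Proof. exact: formal_meromorphic_constant. Qed.
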